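(* Let $X$ be a connected, countable, simple graph with bounded degree, let $x_0\in VX$, and let $t,u\in\mathbb{C}$ with $|t|<1$ and $|u|<1/\alpha(t)$. Then \[ Z_X(u,t,x_0)=\prod_{C\in\mathcal{PK}_{x_0}}\big(1-t^{\mathrm{cbc}(C)}u^{\ell(C)}\big)^{-1/\ell(C)}, \] where the infinite product is the limit as $N\to\infty$ of the finite products over $C\in\mathcal{PK}_{x_0}$ with $\ell(C)\le N$.
   Context: Graphs: $X$ has vertex set $VX$ and oriented edges $EX$, each $e$ with origin $o(e)$, terminus $\mathrm{ter}(e)$ and inverse $\bar e$ ($\bar e\ne e$, $\bar{\bar e}=e$, $o(\bar e)=\mathrm{ter}(e)$); simple = no loops or multiple edges; $\deg(x)=\#\{e:o(e)=x\}$, $M=\max_x\deg(x)<\infty$. A path of length $n$ is $C=(e_1,\dots,e_n)$ with $\mathrm{ter}(e_i)=o(e_{i+1})$, $\ell(C)=n$; it is closed if $\mathrm{ter}(e_n)=o(e_1)$. For a closed path, $\mathrm{cbc}(C)=\#\{i\in\mathbb{Z}/n\mathbb{Z}: e_{i+1}=\bar e_i\}$ (indices mod $n$). The Bartholdi zeta function is $Z_X(u,t,x_0)=\exp\big(\sum_{C}\frac{1}{\ell(C)}t^{\mathrm{cbc}(C)}u^{\ell(C)}\big)$, summed over closed paths $C$ of positive length starting at $x_0$. A closed path $C$ starting at $x_0$ is primitive if it is not the $k$-fold concatenation $D^k$ ($k\ge2$) of a shorter closed path $D$ starting at $x_0$; $\mathcal{PK}_{x_0}$ is the set of primitive closed paths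 of positive length at $x_0$. $\alpha(t)=\frac{M+\sqrt{M^2+4(|t|+1)M}}{2}$. Powers $(1-w)^{-1/\ell}$ use the principal branch. *)

(* Defs.v *)
From HB Require Import structures.
From mathcomp Require Import all_boot all_order all_algebra finmap.
From mathcomp Require Import complex.
From mathcomp Require Import all_classical all_reals all_analysis.
From mathcomp.analysis Require summability.

Set Implicit Arguments.
Unset Strict Implicit.
Unset Printing Implicit Defensive.

Import Order.TTheory GRing.Theory Num.Theory.
Import ComplexField.Normc numFieldNormedType.Exports.

Local Open Scope classical_set_scope.
Local Open Scope complex_scope.
Local Open Scope ring_scope.

(* The library puts the metric topology on a numFieldType only when it is
   abstract; here it is transported to the concrete type R[i]. *)
HB.instance Definition _ (R : rcfType) := NormedModule.copy R[i] R[i]^o.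

Section ComplexFunctions.
Variable R : realType.
Implicit Types z w : R[i].

Definition cexp z : R[i] :=
  let: a +i* b := z in (expR a * cos b) +i* (expR a * sin b).

(* Principal argument, in ]-pi, pi], for z != 0. *)
Definition carg z : R :=
  let: a +i* b := z in
  if 0 <= b then acos (a / normc z) else - acos (a / normc z).

Definition clog z : R[i] := ln (normc z) +i* carg z.

(* Principal branch of z ^ w, for z != 0. *)
Definition cpow z w : R[i] := cexp (w * clog z).

End ComplexFunctions.

(* Graphs in the sense of Serre: every geometric edge is a pair of mutually
   inverse oriented edges. *)
Record graph := Graph {
  vertex : choiceType;
  edge : choiceType;
  org : edge -> vertex;
  ter : edge -> vertex;
  einv : edge -> edge;
  einv_neq : forall e, einv e != e;
  einvK : forall e, einv (einv e) = e;
  org_einv : forall e, org (einv e) = ter e }.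

Section Graphs.
Variable X : graph.
Implicit Types (x y : vertex X) (C D : seq (edge X)).

Definition simple_graph : Prop :=
  (forall e : edge X, org e != ter e) /\
  (forall e f : edge X, org e = org f -> ter e = ter f -> e = f).

(* C is a path from x to y; the empty sequence is the path of length 0. *)
Definition path_between x C y : bool :=
  if C is e :: s then
    [&& org e == x, path (fun f g : edge X => ter f == org g) e s
      & ter (last e s) == y]
  else x == y.

Definition connected_graph : Prop := forall x y, exists C, path_between x C y.

Definition star x : set (edge X) := [set e | org e = x].

(* Meaningful when star x is finite. *)
Definition degree x : nat := #|` fset_set (star x)|%fset.

Definition max_degree (M : nat) : Prop :=
  [/\ forall x, finite_set (star x),
      forall x, (degree x <= M)%N
    & exists x, degree x = M].

(* Closed paths of positive length starting at x. *)
Definition closed_path_at x C : bool := (0 < size C)%N && path_between x C x.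

(* zip C (rot 1 C) lists the pairs (e_i, e_{i+1}), with i in Z/nZ. *)
Definition cbc C : nat := count (fun p => p.2 == einv p.1) (zip C (rot 1 C)).

Definition primitive_closed_path_at x C : Prop :=
  closed_path_at x C /\
  ~ (exists (k : nat) D,
       [/\ (2 <= k)%N, closed_path_at x D & C = flatten (nseq k D)]).

End Graphs.

Section BartholdiZeta.
Variables (R : realType) (X : graph).
Implicit Types (t u : R[i]) (x : vertex X).

Definition alpha (M : nat) t : R :=
  (M%:R + Num.sqrt (M%:R ^+ 2 + 4 * (normc t + 1) * M%:R)) / 2.

Definition zeta_term u t x (C : {C : seq (edge X) | closed_path_at x C}) : R[i] :=
  (size (val C))%:R^-1 * t ^+ cbc (val C) * u ^+ size (val C).

(* The sum over all closed paths is unordered: the limit, along the directed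
   set of finite sets of closed paths, of the finite partial sums. *)
Definition zeta_summable u t x : Prop :=
  cvg (summability.partial_sum (@zeta_term u t x) @ summability.totally).

Definition bartholdi_zeta u t x : R[i] :=
  cexp (summability.sum (@zeta_term u t x)).

Definition euler_product u t x (N : nat) : R[i] :=
  \big[*%R/1]_(C \in [set C | primitive_closed_path_at x C /\ (size C <= N)%N])
    cpow (1 - t ^+ cbc C * u ^+ size C) (- (size C)%:R^-1).

End BartholdiZeta.

(* Main.v *)
(* At most M^n closed paths of length n start at x0, and alpha(t) >= M, so
   q = M |u| < 1 and the zeta sum is dominated by a geometric series.

   Every closed path at x0 is D^k for a unique primitive D and a unique k >= 1
   (words that commute are powers of a common word), and cbc(D^k) = k cbc(D).
   Hence the sum S_N over the closed paths of length <= N regroups as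
     sum_(D primitive, l(D) <= N) (1/l(D)) sum_(1 <= k <= N/l(D)) w_D^k / k,
   where w_D = t^cbc(D) u^l(D).  Replacing each inner sum by -log(1 - w_D) costs
   O(|u|^N) per D, that is O(N q^N) in total.  So the logarithm of the N-th
   Euler product, -sum_D (1/l(D)) log(1 - w_D), has the same limit as S_N. *)
Require Import Defs.
From HB Require Import structures.
From mathcomp Require Import all_boot all_order all_algebra finmap.
From mathcomp Require Import complex.
From mathcomp Require Import all_classical all_reals all_analysis.
From mathcomp Require Import ring lra zify.

Set Implicit Arguments.
Unset Strict Implicit.
Unset Printing Implicit Defensive.

Import Order.TTheory GRing.Theory Num.Theory.
Import ComplexField.Normc numFieldNormedType.Exports.

Local Open Scope classical_set_scope.
Local Open Scope complex_scope.
Local Open Scope ring_scope.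

(** * The principal logarithm and the exponential *)

Section Normc.
Variable R : realType.
Implicit Types (z w : R[i]).

Lemma normc_ge0 z : 0 <= normc z.
Proof. by case: z => a b; exact: sqrtr_ge0. Qed.

Lemma normcX z n : normc (z ^+ n) = normc z ^+ n.
Proof. by elim: n => [|n IH]; rewrite ?expr0 ?normc1 // !exprS normcM IH. Qed.

Lemma normc_real (s : R) : normc s%:C = `|s|.
Proof. by rewrite /= expr0n addr0 sqrtr_sqr. Qed.

Lemma normc_nat n : normc (n%:R : R[i]) = n%:R.
Proof. by rewrite -(rmorph_nat (real_complex R)) normc_real ger0_norm. Qed.

Lemma normcB z w : normc (z - w) = normc (w - z).
Proof. by rewrite -[LHS]normcN opprB. Qed.

Lemma normc_sum (I : Type) (r : seq I) (P : pred I) (F : I -> R[i]) :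
  normc (\sum_(i <- r | P i) F i) <= \sum_(i <- r | P i) normc (F i).
Proof.
elim/big_rec2: _ => [|i x y _ le_yx]; first by rewrite normc0.
by apply: le_trans (le_normcD _ _) _; rewrite lerD2l.
Qed.

Lemma Re_le_normc z : `|complex.Re z| <= normc z.
Proof. by case: z => a b /=; rewrite -sqrtr_sqr ler_sqrt ?lerDl ?sqr_ge0 ?addr_ge0 ?sqr_ge0. Qed.

Lemma Im_le_normc z : `|complex.Im z| <= normc z.
Proof. by case: z => a b /=; rewrite -sqrtr_sqr ler_sqrt ?lerDr ?sqr_ge0 ?addr_ge0 ?sqr_ge0. Qed.

Lemma normc_le_ReIm z : normc z <= `|complex.Re z| + `|complex.Im z|.
Proof.
case: z => a b /=; rewrite -[leRHS]ger0_norm ?addr_ge0 // -sqrtr_sqr.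
rewrite ler_sqrt ?sqr_ge0 // sqrrD !real_normK ?num_real //.
by rewrite lerD2r lerDl mulrn_wge0 ?mulr_ge0.
Qed.

Lemma ReD z w : complex.Re (z + w) = complex.Re z + complex.Re w. Proof. by case: z; case: w. Qed.
Lemma ImD z w : complex.Im (z + w) = complex.Im z + complex.Im w. Proof. by case: z; case: w. Qed.
Lemma ReB z w : complex.Re (z - w) = complex.Re z - complex.Re w. Proof. by case: z; case: w. Qed.
Lemma ImB z w : complex.Im (z - w) = complex.Im z - complex.Im w. Proof. by case: z; case: w. Qed.
Lemma ReZ (s : R) z : complex.Re (s%:C * z) = s * complex.Re z.
Proof. by case: z => a b /=; ring. Qed.
Lemma ImZ (s : R) z : complex.Im (s%:C * z) = s * complex.Im z.
Proof. by case: z => a b /=; ring. Qed.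

End Normc.

(** * Taylor remainder of the principal logarithm, and the exponential law *)

Section Log.
Variable R : realType.
Implicit Types (z w : R[i]).

Lemma is_derive_powsum (c : nat -> R) n (s : R) :
  is_derive s 1 (fun x : R => \sum_(k < n) x ^+ k.+1 * (k.+1%:R^-1 * c k))
    (\sum_(k < n) s ^+ k * c k).
Proof.
rewrite (_ : (fun x : R => _) =
    \sum_(k < n) (k.+1%:R^-1 * c k) \*: (@id R : R -> R) ^+ k.+1); last first.
  apply/funext => x; rewrite fct_sumE; apply: eq_bigr => k _.
  by rewrite exprfctE mulrC.
apply: is_derive_eq; apply: eq_bigr => k _ /=.
rewrite /GRing.scale /= mulr1 mulrC mulrA; congr (_ * _).
by rewrite mulrC mulrA mulVf ?mul1r.
Qed.

(** As functions of s, -log(1 - s w) has derivative w / (1 - s w) and its Taylor polynomial has the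
    truncated geometric series as derivative, so the right-hand side is the derivative of the Taylor
    remainder. *)
Lemma geom_remainder w (s : R) n : 1 - s%:C * w != 0 ->
  w / (1 - s%:C * w) - \sum_(k < n) s%:C ^+ k * w ^+ k.+1 =
  s%:C ^+ n * w ^+ n.+1 / (1 - s%:C * w).
Proof.
move=> nz; elim: n => [|n IH].
  by rewrite big_ord0 subr0 expr0 mul1r expr1.
rewrite big_ord_recr /= opprD addrA IH !exprS; field.
exact: nz.
Qed.

(** Keeps the denominators away from 0 along the whole segment from 0 to w. *)
Lemma normc_subr_ge w (s : R) : 0 <= s <= 1 -> normc w < 1 ->
  1 - normc w <= normc (1 - s%:C * w).
Proof.
move=> /andP[s0 s1] w1.
have := le_normcD (1 - s%:C * w) (s%:C * w); rewrite subrK normc1.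
rewrite normcM normc_real ger0_norm // => h.
have : s * normc w <= normc w by rewrite ler_piMl ?normc_ge0.
lra.
Qed.

(* Mean value theorem on [0, 1] for the difference between [f] and the n-th
   Taylor polynomial of phi(- log(1 - s w)), where phi is Re or Im. *)
Lemma log_taylor_bound (phi : R[i] -> R) (f : R -> R) w n :
  {morph phi : x y / x + y} ->
  (forall (s : R) z, phi (s%:C * z) = s * phi z) ->
  (forall z, `|phi z| <= normc z) -> normc w < 1 ->
  (forall s : R, 0 <= s <= 1 -> is_derive s 1 f (phi (w / (1 - s%:C * w)))) ->
  `|f 1 - f 0 - phi (\sum_(k < n) w ^+ k.+1 / k.+1%:R)| <=
     normc w ^+ n.+1 / (1 - normc w).
Proof.
move=> phiD phiZ phi_le w1 df.
have phi0 : phi 0 = 0 by have := phiZ 0 0; rewrite mulr0 mul0r.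
have phiB x y : phi (x - y) = phi x - phi y.
  by rewrite phiD -mulN1r -(rmorphN1 (real_complex R)) phiZ mulN1r.
have phis m (F : 'I_m -> R[i]) : phi (\sum_k F k) = \sum_k phi (F k).
  by rewrite (big_morph phi phiD phi0).
(* [g x] is [phi] of the Taylor polynomial at x w, the powers of x being pulled out by real
   linearity; [dh] is the derivative of [f - g]. *)
pose g (x : R) := \sum_(k < n) x ^+ k.+1 * (k.+1%:R^-1 * phi (w ^+ k.+1)).
pose dh (s : R) := phi (w / (1 - s%:C * w)) - \sum_(k < n) s ^+ k * phi (w ^+ k.+1).
have dfg (s : R) : 0 <= s <= 1 -> is_derive s 1 (f - g) (dh s).
  move=> s01; apply: is_deriveB; first exact: df.
  exact: (is_derive_powsum (fun k => phi (w ^+ k.+1))).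
have [||c /[!in_itv]/= c01] := @MVT_segment R (f - g) dh 0 1 ler01.
- by move=> x /[!in_itv]/= /andP[x0 x1]; apply: dfg; rewrite !ltW.
- apply: derivable_within_continuous => x /[!in_itv]/= x01.
  by case: (dfg x x01).
rewrite subr0 mulr1 => E.
have -> : f 1 - f 0 - phi (\sum_(k < n) w ^+ k.+1 / k.+1%:R) = dh c.
  rewrite -E /= !fctE /g phis.
  rewrite (eq_bigr (fun k : 'I_n => 1 ^+ k.+1 * (k.+1%:R^-1 * phi (w ^+ k.+1)))); last first.
    move=> k _; rewrite expr1n mul1r -phiZ; congr phi.
    by rewrite rmorphV ?unitfE // rmorph_nat mulrC.
  rewrite [X in _ = _ - (f 0 - X)]big1; last by move=> k _; rewrite expr0n mul0r.
  ring.
have nz : 1 - c%:C * w != 0.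
  apply/eqP => e0; have := normc_subr_ge c01 w1; rewrite e0 normc0; lra.
have -> : dh c = phi (c%:C ^+ n * w ^+ n.+1 / (1 - c%:C * w)).
  rewrite -geom_remainder // phiB phis; congr (_ - _).
  by apply: eq_bigr => k _; rewrite -phiZ rmorphXn.
apply: le_trans (phi_le _) _.
rewrite normcM normcV normcM !normcX normc_real.
have w1' : 0 < 1 - normc w by lra.
have := normc_subr_ge c01 w1 => h.
apply: ler_pM; rewrite ?mulr_ge0 ?exprn_ge0 ?invr_ge0 ?normc_ge0 //.
  rewrite ler_piMl ?exprn_ge0 ?normc_ge0 // exprn_ile1 //.
  by case/andP: c01 => *; rewrite ger0_norm.
by rewrite lef_pV2 // posrE ?(lt_le_trans _ h).
Qed.

(** Trades the [acos] and the case split of [carg] for a function that is easy to differentiate.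
    Here a / |z| is the cosine of atan(|b| / a), an angle in [0, pi], and the sign of b is restored
    because atan is odd. *)
Lemma carg_atan (z : R[i]) : 0 < complex.Re z -> carg z = atan (complex.Im z / complex.Re z).
Proof.
case: z => a b /= a0; rewrite /carg.
have nE : a / normc (a +i* b) = cos (atan (`|b| / a)).
  rewrite cos_atan /=.
  rewrite -[a in LHS]invrK -invfM; congr (_^-1).
  rewrite -[a in X in X * _](gtr0_norm a0) -sqrtr_sqr.
  rewrite -sqrtrV ?sqr_ge0 // -sqrtrM ?invr_ge0 ?sqr_ge0 //; congr Num.sqrt.
  rewrite expr_div_n real_normK ?num_real //; field.
  by rewrite gt_eqF.
have ge0 : 0 <= atan (`|b| / a).
  by rewrite -(@atan0 R); apply: le_atan; rewrite divr_ge0 // ltW.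
have lepi : atan (`|b| / a) <= pi.
  by have := atan_ltpi2 (`|b| / a); have := pi_gt0 R; lra.
rewrite nE cosK ?in_itv /= ?ge0 //.
case: (leP 0 b) => b0; first by rewrite ger0_norm.
by rewrite -atanN ltr0_norm // mulNr opprK.
Qed.

Lemma div_complex (a b c d : R) : (a +i* b) / (c +i* d) =
  ((a * c + b * d) / (c ^+ 2 + d ^+ 2)) +i* ((b * c - a * d) / (c ^+ 2 + d ^+ 2)).
Proof. by apply/eqP; rewrite eq_complex /=; apply/andP; split; apply/eqP; ring. Qed.

Lemma is_derive_affine (c d s : R) : is_derive s 1 (fun x : R => c + x * d) d.
Proof.
rewrite (_ : (fun x : R => _) = cst c + (d \*: @id R : R -> R)); last first.
  by apply/funext => x; rewrite mulrC.
by apply: is_derive_eq; rewrite /GRing.scale /= add0r mulr1.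
Qed.

(** The mean value theorem serves real functions only, so the real and imaginary parts are bounded
    separately; this gives the factor 2. *)
Lemma clog_taylor_bound w n : normc w < 1 ->
  normc (- clog (1 - w) - \sum_(k < n) w ^+ k.+1 / k.+1%:R) <=
    2 * (normc w ^+ n.+1 / (1 - normc w)).
Proof.
move=> w1; apply: le_trans (normc_le_ReIm _) _; rewrite ReB ImB.
rewrite mulrDl mul1r; case E : w => [a b]; rewrite -E.
(* The real part of 1 - s w stays positive. The shapes [1 + s * - a] and [0 + s * b] are those of
   [is_derive_affine]. *)
have q0 (s : R) : 0 <= s <= 1 -> 0 < 1 + s * - a.
  move=> s01; have /andP[s0 s1] := s01.
  have h : `|a| <= normc w by rewrite E; exact: (Re_le_normc (a +i* b)).
  have : s * a <= normc w.
    apply: le_trans (ler_norm _) _; rewrite normrM ger0_norm //.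
    by apply: le_trans h; rewrite ler_piMl.
  by rewrite mulrN; lra.
have d0 (s : R) : 0 <= s <= 1 -> 0 < (1 + s * - a) ^+ 2 + (0 + s * b) ^+ 2.
  by move=> /q0 h; rewrite ltr_pwDl ?sqr_ge0 ?exprn_gt0.
have wE (s : R) : w / (1 - s%:C * w) =
    ((a * (1 + s * - a) - b * (0 + s * b)) / ((1 + s * - a) ^+ 2 + (0 + s * b) ^+ 2)) +i*
    ((b * (1 + s * - a) + a * (0 + s * b)) / ((1 + s * - a) ^+ 2 + (0 + s * b) ^+ 2)).
  have -> : 1 - s%:C * w = (1 + s * - a) +i* (- (0 + s * b)).
    by rewrite E; apply/eqP; rewrite eq_complex /=; apply/andP; split; apply/eqP; ring.
  by rewrite E div_complex sqrrN !mulrN opprK.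
have r01 : 0 <= (1 : R) <= 1 by rewrite ler01 lexx.
have oneE : 1 - w = (1 - a) +i* (- b) by rewrite E; simpc.
apply: lerD.
(* The logarithm of |1 - w| is half that of its square, which spares differentiating a square
   root. *)
- have -> : complex.Re (- clog (1 - w)) = - 2^-1 * ln ((1 - a) ^+ 2 + b ^+ 2).
    rewrite oneE /clog /= sqrrN.
    have := d0 _ r01; rewrite !mul1r add0r => p0.
    by rewrite -[in RHS](sqr_sqrtr (ltW p0)) lnXn ?sqrtr_gt0 // -mulr_natl; field.
  have := @log_taylor_bound (@complex.Re R)
    (fun s => - 2^-1 * ln ((1 + s * - a) ^+ 2 + (0 + s * b) ^+ 2)) w n.
  rewrite !mul0r !mul1r !addr0 expr0n expr1n /= addr0 ln1 mulr0 subr0 add0r.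
  apply => //.
  + exact: ReD.
  + exact: ReZ.
  + exact: Re_le_normc.
  + move=> s s01; rewrite wE /=.
    have d1 : is_derive s 1 ((fun x => 1 + x * - a) ^+ 2 + (fun x => 0 + x * b) ^+ 2 : R -> R)
       (2 * (b * (0 + s * b) - a * (1 + s * - a))).
      have h1 := is_derive_affine 1 (- a) s.
      have h2 := is_derive_affine 0 b s.
      by apply: is_derive_eq; rewrite /GRing.scale /= !expr1; ring.
    have d2 := is_derive1_ln (d0 _ s01).
    have d3 := @is_derive1_comp R (@ln R) _ s _ _ d2 d1.
    have d4 := is_deriveZ (- 2^-1) d3.
    apply: (is_derive_eq d4).
    by rewrite /GRing.scale /=; field; rewrite gt_eqF //; have := d0 _ s01; rewrite !mulrN add0r.
- have -> : complex.Im (- clog (1 - w)) = atan (b / (1 - a)).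
    have := q0 _ r01; rewrite mul1r => p0.
    by rewrite oneE -[LHS]/(- carg _) carg_atan //= mulNr atanN opprK.
  have := @log_taylor_bound (@complex.Im R)
    (fun s => atan ((0 + s * b) / (1 + s * - a))) w n.
  rewrite !mul0r !mul1r !addr0 mul0r atan0 subr0 add0r.
  apply => //.
  + exact: ImD.
  + exact: ImZ.
  + exact: Im_le_normc.
  + move=> s s01; rewrite wE /=.
    have h1 := is_derive_affine 1 (- a) s.
    have h2 := is_derive_affine 0 b s.
    have p0 := q0 _ s01.
    have nz : 1 + s * - a != 0 by rewrite gt_eqF.
    have h3 := @is_deriveV R (fun x => 1 + x * - a) s _ _ nz h1.
    have h4 := is_deriveM h2 h3.
    have h5 := @is_derive1_comp R (@atan R) _ s _ _ (is_derive1_atan _) h4.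
    apply: (is_derive_eq h5).
    rewrite /GRing.scale /=.
    rewrite !fctE; field.
    by rewrite nz andbT gt_eqF //; have := d0 _ s01; rewrite add0r.
Qed.

Lemma cexpD z w : cexp (z + w) = cexp z * cexp w.
Proof.
case: z w => a b [c d]; apply/eqP; rewrite eq_complex /= expRD cosD sinD.
by apply/andP; split; apply/eqP; ring.
Qed.

Lemma cexp0 : cexp (0 : R[i]) = 1.
Proof. by rewrite /cexp /= expR0 cos0 sin0 mulr1 mulr0. Qed.

Lemma cexp_sum (I : Type) (r : seq I) (P : pred I) (F : I -> R[i]) :
  cexp (\sum_(i <- r | P i) F i) = \prod_(i <- r | P i) cexp (F i).
Proof. exact: (big_morph _ cexpD cexp0). Qed.

End Log.

(** * Convergence in [R[i]] through the modulus and the real and imaginary parts *)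

Section Convergence.
Variables (R : realType) (T : Type) (F : set_system T).
Hypothesis FF : Filter F.
Implicit Types (f : T -> R[i]) (l : R[i]).

(** Radii of balls in [R[i]] are themselves elements of [R[i]]; being positive they are real, so
    they correspond to the radii in [R]. *)
Lemma cvg_normcP f l : (f @ F --> l) <-> (fun x => normc (l - f x)) @ F --> (0 : R).
Proof.
split => [/cvgrPdist_lt fl|/cvgrPdist_lt fl].
  apply/cvgrPdist_lt => e e0; have /fl : 0 < e%:C by rewrite ltcR.
  apply: filterS => x h; rewrite sub0r normrN ger0_norm ?normc_ge0 //.
  by rewrite -ltcR; exact: h.
apply/cvgrPdist_lt => e e0.
have eE : (complex.Re e)%:C = e by apply: RRe_real; exact: gtr0_real.
have : 0 < complex.Re e by rewrite -ltcR eE.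
move=> /fl; apply: filterS => x; rewrite sub0r normrN ger0_norm ?normc_ge0 //.
by rewrite -ltcR eE.
Qed.

Lemma cvg_complexP f l : (f @ F --> l) <->
  ((fun x => complex.Re (f x)) @ F --> complex.Re l) /\
  ((fun x => complex.Im (f x)) @ F --> complex.Im l).
Proof.
split => [/cvg_normcP fl|[fr fi]].
  split; apply/cvgrPdist_lt => e e0; have /cvgrPdist_lt/(_ e e0) := fl;
    apply: filterS => x; rewrite sub0r normrN ger0_norm ?normc_ge0 //;
    apply: le_lt_trans.
    by rewrite -ReB Re_le_normc.
  by rewrite -ImB Im_le_normc.
apply/cvg_normcP/(squeeze_cvgr (f := fun=> 0)
  (h := fun x => `|complex.Re (l - f x)| + `|complex.Im (l - f x)|)).
- by apply: nearW => x; rewrite normc_ge0 normc_le_ReIm.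
- exact: cvg_cst.
- rewrite -[X in _ --> X]addr0; apply: cvgD; rewrite -(@normr0 _ R);
    apply: cvg_norm.
    by under eq_fun do rewrite ReB; rewrite -(subrr (complex.Re l));
      apply: cvgB => //; exact: cvg_cst.
  by under eq_fun do rewrite ImB; rewrite -(subrr (complex.Im l));
    apply: cvgB => //; exact: cvg_cst.
Qed.

Lemma cvg_cexp f l : f @ F --> l -> (fun x => cexp (f x)) @ F --> cexp l.
Proof.
move=> /cvg_complexP[fr fi].
have cE : (expR (complex.Re (f x)) @[x --> F] --> expR (complex.Re l)).
  by apply: (cvg_comp _ _ fr); exact: continuous_expR.
have cC : (cos (complex.Im (f x)) @[x --> F] --> cos (complex.Im l)).
  by apply: (cvg_comp _ _ fi); exact: continuous_cos.
have cS : (sin (complex.Im (f x)) @[x --> F] --> sin (complex.Im l)).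
  by apply: (cvg_comp _ _ fi); exact: continuous_sin.
apply/cvg_complexP; split.
  rewrite (_ : (fun _ => _) = (fun x => expR (complex.Re (f x)) * cos (complex.Im (f x)))).
    by rewrite (_ : complex.Re (cexp l) = expR (complex.Re l) * cos (complex.Im l));
      [apply: cvgM|case: (l)].
  by apply/funext => x /=; case: (f x).
rewrite (_ : (fun _ => _) = (fun x => expR (complex.Re (f x)) * sin (complex.Im (f x)))).
  by rewrite (_ : complex.Im (cexp l) = expR (complex.Re l) * sin (complex.Im l));
    [apply: cvgM|case: (l)].
by apply/funext => x /=; case: (f x).
Qed.

End Convergence.

(** * Words and closed paths *)

Section Words.
Variable T : eqType.
Implicit Types (s t D : seq T).

Definition seqpow k s : seq T := flatten (nseq k s).

Lemma seqpowS k s : seqpow k.+1 s = s ++ seqpow k s.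
Proof. by []. Qed.

Lemma seqpow1 s : seqpow 1 s = s.
Proof. exact: cats0. Qed.

Lemma seqpowD j k s : seqpow (j + k) s = seqpow j s ++ seqpow k s.
Proof. by rewrite /seqpow nseqD flatten_cat. Qed.

Lemma seqpowM j k s : seqpow j (seqpow k s) = seqpow (j * k) s.
Proof. by elim: j => // j IH; rewrite seqpowS IH mulSn seqpowD. Qed.

Lemma size_seqpow k s : size (seqpow k s) = (k * size s)%N.
Proof. by elim: k => // k IH; rewrite seqpowS size_cat IH mulSn. Qed.

(** Euclid's algorithm on lengths: the shorter word s is a prefix of t, and s commutes with what
    remains of t once this prefix is removed. An empty s is treated apart, since the total length
    would not drop. *)
Lemma commuting_words s t : s ++ t = t ++ s ->
  exists r a b, s = seqpow a r /\ t = seqpow b r.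
Proof.
have [n] := ubnP (size s + size t); elim: n s t => // n IH s t le_n st.
wlog le_st : s t le_n st / (size s <= size t)%N.
  move=> wl; case: (leqP (size s) (size t)) => [/wl|/ltnW/wl]; first exact.
  case=> [||r [a [b [-> ->]]]]; [by rewrite addnC|by []|by exists r, b, a].
case: (posnP (size s)) => [/size0nil ->|s_gt0].
  by exists t, 0, 1; rewrite seqpow1.
have tE : t = s ++ drop (size s) t.
  have := congr1 (take (size s)) st.
  by rewrite take_size_cat // takel_cat // => {1}->; rewrite cat_take_drop.
have st' : s ++ drop (size s) t = drop (size s) t ++ s.
  have : s ++ s ++ drop (size s) t = s ++ drop (size s) t ++ s.
    by rewrite -tE catA -tE.
  by move/eqP; rewrite eqseq_cat // eqxx => /eqP.
have [||r [a [b [sE dE]]]] := IH s (drop (size s) t); last 1 first.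
- by exists r, a, (a + b)%N; split=> //; rewrite tE seqpowD -dE -sE.
- by rewrite size_drop; lia.
- exact: st'.
Qed.

(** Isolating one leading copy of s leaves a full power in the middle, ready to be rewritten as a
    power of another word. *)
Lemma seqpow_double j s :
  seqpow j.+1 s ++ seqpow j.+1 s = s ++ seqpow j.+1 s ++ seqpow j s.
Proof. by rewrite {1}seqpowS -catA -!seqpowD addnC. Qed.

(** If W is the common power, W W begins with s t and also with t s, two prefixes of equal
    length. *)
Lemma seqpow_eq_comm j k s t : seqpow j.+1 s = seqpow k.+1 t -> s ++ t = t ++ s.
Proof.
move=> E.
have /eqP : (s ++ t) ++ (seqpow k t ++ seqpow j s) = (t ++ s) ++ (seqpow j s ++ seqpow k t).
  transitivity (seqpow j.+1 s ++ seqpow j.+1 s).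
    by rewrite seqpow_double E seqpowS -!catA.
  by rewrite E seqpow_double -E seqpowS -!catA.
rewrite eqseq_cat; last by rewrite !size_cat addnC.
by move=> /andP[/eqP].
Qed.

End Words.

(** * Closed paths and their primitive roots *)

Section ClosedPaths.
Variable X : graph.
Implicit Types (x y : vertex X) (C D : seq (edge X)).

Lemma path_between_cat C D x y z : path_between x C y -> path_between y D z ->
  path_between x (C ++ D) z.
Proof.
case: C => [/eqP -> //|e s] /= /and3P[-> p /eqP <-].
case: D => [|f r] /=; first by rewrite cats0 p.
by move=> /and3P[/eqP fe r2 lr]; rewrite cat_path last_cat p /= fe eqxx r2 lr.
Qed.

Lemma path_between_catl C D x z : path_between x (C ++ D) z ->
  exists2 y, path_between x C y & path_between y D z.
Proof.
case: C => [|e s] /=; first by exists x.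
rewrite cat_path last_cat => /and3P[ex /andP[p pD] lz].
exists (ter (last e s)); first by rewrite ex p eqxx.
by case: D pD lz => //= f r /andP[/eqP -> ->] ->; rewrite eqxx.
Qed.

Lemma path_between_org C x y z w :
  (0 < size C)%N -> path_between x C y -> path_between z C w -> x = z.
Proof. by case: C => // e s _ /= /and3P[/eqP <- _ _] /and3P[/eqP <- _ _]. Qed.

Lemma closed_path_edge x C : closed_path_at x C -> exists e, star x e.
Proof. by case: C => // e s /and3P[_ /eqP ex _]; exists e. Qed.

Lemma closed_path_seqpow k D x : closed_path_at x D -> closed_path_at x (seqpow k.+1 D).
Proof.
move=> /andP[D0 pD]; rewrite /closed_path_at size_seqpow muln_gt0 /= D0 /=.
elim: k => [|k IH]; first by rewrite seqpow1.
by rewrite seqpowS; apply: path_between_cat pD IH.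
Qed.

(** With two consecutive copies of D, the end of the first is the origin of the second, which is the
    origin x of the first. *)
Lemma closed_path_root k D x : closed_path_at x (seqpow k.+2 D) -> closed_path_at x D.
Proof.
case/andP; rewrite size_seqpow muln_gt0 => /andP[_ D0].
rewrite !seqpowS => /path_between_catl[y p1 /path_between_catl[z p2 _]].
by have xy := path_between_org D0 p1 p2; rewrite /closed_path_at D0 {2}xy.
Qed.

(** Strong induction on length: a closed path that is not primitive is a power of a strictly shorter
    one. *)
Lemma primitive_root_exists C x : closed_path_at x C ->
  exists D k, primitive_closed_path_at x D /\ C = seqpow k.+1 D.
Proof.
have [n] := ubnP (size C); elim: n C => // n IH C le_n cC.
have [[k [D [k2 cD CE]]]|np] := pselect (exists (k : nat) D,
       [/\ (2 <= k)%N, closed_path_at x D & C = flatten (nseq k D)]); last first.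
  by exists C, 0%N; rewrite seqpow1.
have [|//|E [j [pE DE]]] := IH D.
  have := cD => /andP[D0 _]; move: le_n; rewrite CE -/(seqpow k D) size_seqpow ltnS.
  exact/leq_trans/(ltn_Pmull k2 D0).
exists E, (k * j.+1).-1; split => //; rewrite prednK ?muln_gt0 //; last by rewrite andbT; lia.
by rewrite CE -/(seqpow k D) DE seqpowM.
Qed.

(** Exponent 0 would make D empty; for an exponent at least 2, [closed_path_root] makes r a closed
    path at x, against primitivity. *)
Lemma primitive_not_pow a D r x : primitive_closed_path_at x D ->
  D = seqpow a r -> a = 1%N.
Proof.
move=> [cD np] DE; case: a DE => [|[|a]] DE //.
  by move: cD; rewrite DE.
case: np; exists a.+2, r; split => //.
by apply: (closed_path_root (k := a)); rewrite -DE.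
Qed.

(** Equal powers force D and E to commute, hence to be powers of one word r; primitivity makes both
    exponents 1, and lengths then identify j and k. *)
Lemma primitive_root_uniq j k D E x :
  primitive_closed_path_at x D -> primitive_closed_path_at x E ->
  seqpow j.+1 D = seqpow k.+1 E -> D = E /\ j = k.
Proof.
move=> pD pE DE.
have [r [a [b [Da Eb]]]] := commuting_words (seqpow_eq_comm DE).
have DEeq : D = E.
  by rewrite Da Eb (primitive_not_pow pD Da) (primitive_not_pow pE Eb).
split=> //; have := congr1 size DE; rewrite !size_seqpow DEeq.
have [/andP[E0 _] _] := pE.
by move/eqP; rewrite eqn_pmul2r // eqSS => /eqP.
Qed.

(** Rotating a power of D by one edge gives the same power of the rotated D, so the cyclic list of
    consecutive pairs of the power is that of D repeated. *)
Lemma cbc_seqpow k D : (0 < size D)%N -> cbc (seqpow k.+1 D) = (k.+1 * cbc D)%N.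
Proof.
case: D => // e s _; pose f := rcons s e.
have rotE j : e :: seqpow j f = rcons (seqpow j (e :: s)) e.
  by elim: j => // j IH; rewrite !seqpowS rcons_cat -IH cat_rcons.
have zipE j : zip (seqpow j (e :: s)) (seqpow j f) = seqpow j (zip (e :: s) f).
  by elim: j => // j IH; rewrite !seqpowS zip_cat ?IH // size_rcons.
rewrite /cbc; have -> : rot 1 (seqpow k.+1 (e :: s)) = seqpow k.+1 f.
  by rewrite seqpowS cat_cons rot1_cons rcons_cat -rotE -cat_rcons.
rewrite rot1_cons zipE; elim: {k}k.+1 => // k IH.
by rewrite seqpowS count_cat IH mulSn.
Qed.

End ClosedPaths.

(** * Finite enumeration and counting of closed paths by length *)

Section Enumeration.
Variables (X : graph) (K : nat).
Hypothesis star_fin : forall x : vertex X, finite_set (star x).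
Hypothesis degK : forall x : vertex X, (degree x <= K)%N.
Implicit Types (x y : vertex X) (C D : seq (edge X)).

(** The end point is left free, so that the bound K^n follows by a plain induction on n. *)
Fixpoint walks n x : seq (seq (edge X)) :=
  if n is n'.+1 then
    [seq e :: s | e <- fset_set (star x) : seq (edge X), s <- walks n' (ter e)]
  else [:: [::]].

Lemma mem_walks x y C : path_between x C y -> C \in walks (size C) x.
Proof.
elim: C x => [|e s IH] x; first by rewrite inE.
move=> /= /and3P[/eqP ex p l]; apply/allpairsPdep; exists e, s; split => //.
  by rewrite in_fset_set // inE.
apply: IH; case: s p l => //= f r /andP[/eqP -> ->] ->; by rewrite eqxx.
Qed.

Lemma size_walks n x : (size (walks n x) <= K ^ n)%N.
Proof.
elim: n x => // n IH x /=; rewrite size_allpairs_dep sumnE big_map.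
apply: (@leq_trans (\sum_(e <- fset_set (star x)) K ^ n)).
  by apply: leq_sum.
rewrite big_const_seq count_predT iter_addn_0 expnSr leq_mul2l; apply/orP; right; exact: degK.
Qed.

Definition closed_upto x N : set (seq (edge X)) :=
  [set C | closed_path_at x C /\ (size C <= N)%N].

Definition prim_upto x N : set (seq (edge X)) :=
  [set C | primitive_closed_path_at x C /\ (size C <= N)%N].

Lemma finite_closed_upto x N : finite_set (closed_upto x N).
Proof.
apply: (@sub_finite_set _ _ [set` flatten [seq walks n x | n <- iota 0 N.+1]]).
  move=> C [/andP[_ pC] CN].
  suff : C \in flatten [seq walks n x | n <- iota 0 N.+1] by [].
  apply/flatten_mapP; exists (size C).
    by rewrite mem_iota.
  exact: mem_walks pC.
exact: finite_seq.
Qed.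

Lemma finite_prim_upto x N : finite_set (prim_upto x N).
Proof. by apply: sub_finite_set (finite_closed_upto x N) => C [[]]. Qed.

Lemma mem_closed_upto x N C :
  (C \in (fset_set (closed_upto x N) : seq _)) = closed_path_at x C && (size C <= N)%N.
Proof.
rewrite in_fset_set; last exact: finite_closed_upto.
by apply/idP/idP => [/set_mem[-> ->]|/andP[? ?]]; [|apply/mem_set].
Qed.

Lemma mem_prim_upto x N C :
  reflect (primitive_closed_path_at x C /\ (size C <= N)%N)
    (C \in (fset_set (prim_upto x N) : seq _)).
Proof.
rewrite in_fset_set; last exact: finite_prim_upto.
by apply: (iffP idP) => [/set_mem|/mem_set].
Qed.

(** At most K^n members of the list have length n. The list is arbitrary so as to cover both the
    primitive paths and any finite family of closed paths. *)
Lemma sum_by_length (R : realDomainType) x (r : seq (seq (edge X))) (F : nat -> R) B :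
  (forall n, 0 <= F n) -> uniq r -> {in r, forall C, closed_path_at x C} ->
  {in r, forall C, (size C < B)%N} ->
  \sum_(C <- r) F (size C) <= \sum_(n < B) K%:R ^+ n * F n.
Proof.
move=> F0 ur cr sr.
have -> : \sum_(C <- r) F (size C) = \sum_(n < B) \sum_(C <- r | size C == n) F n.
  rewrite (exchange_big_dep predT) //= [LHS]big_seq [RHS]big_seq.
  apply: eq_bigr => C /sr CB; rewrite (big_pred1 (Ordinal CB)) //.
apply: ler_sum => n _; rewrite -big_filter big_const_seq count_predT iter_addr_0.
rewrite -[leLHS]mulr_natl -natrX ler_wpM2r // ler_nat.
apply: leq_trans (size_walks n x); apply: uniq_leq_size; first exact: filter_uniq.
by move=> C; rewrite mem_filter => /andP[/eqP <- /cr /andP[_ /mem_walks]].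
Qed.

(* Unique factorisation: a closed path is a power of exactly one primitive
   closed path, with a unique exponent. *)
Lemma big_closed_upto (R : Type) (idx : R) (op : Monoid.com_law idx)
    (F : seq (edge X) -> R) x N :
  \big[op/idx]_(C <- fset_set (closed_upto x N)) F C =
  \big[op/idx]_(D <- fset_set (prim_upto x N))
     \big[op/idx]_(k <- iota 0 (N %/ size D)) F (seqpow k.+1 D).
Proof.
(* Both sides range over duplicate-free lists with the same members: k < N / l(D) exactly when (k +
   1) l(D) <= N. *)
rewrite -(big_allpairs_dep (h := fun D k => seqpow k.+1 D)).
apply: perm_big; apply: uniq_perm; first exact: fset_uniq.
  apply: allpairs_uniq_dep => //=; first exact: fset_uniq.
    by move=> D _; exact: iota_uniq.
  move=> [D j] [E k] /allpairsPdep[D' [j' [/mem_prim_upto[pD _] _ [-> ->]]]].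
  move=> /allpairsPdep[E' [k' [/mem_prim_upto[pE _] _ [-> ->]]]] /=.
  by move=> /(primitive_root_uniq pD pE)[-> ->].
move=> C; rewrite mem_closed_upto; apply/andP/allpairsPdep.
  move=> [/primitive_root_exists[D [k [pD ->]]]].
  have [/andP[D0 _] _] := pD; rewrite size_seqpow => le_N.
  exists D, k; split => //; last by rewrite mem_iota /= leq_divRL.
  by apply/mem_prim_upto; split => //; apply: leq_trans le_N; rewrite leq_pmull.
move=> [D [k [/mem_prim_upto[[cD _] _] + ->]]].
have /andP[D0 _] := cD.
rewrite mem_iota add0n leq_divRL //= size_seqpow => ->.
by split=> //; exact: closed_path_seqpow.
Qed.

End Enumeration.

(** * Convergence of the sum and of the product *)

Section Geometric.
Variable R : realType.
Implicit Types (p : R).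

Lemma geometric_sum_le p n : 0 <= p < 1 -> \sum_(i < n) p ^+ i <= (1 - p)^-1.
Proof.
move=> /andP[p0 p1]; have q0 : 0 < 1 - p by lra.
rewrite -[leRHS]mul1r ler_pdivlMr // mulrC -opprB mulNr -subrX1.
by have := exprn_ge0 n p0; lra.
Qed.

(** Each of the n terms p^i with i < n is at least p^n. *)
Lemma mulrn_exp_le p n : 0 <= p < 1 -> n%:R * p ^+ n <= (1 - p)^-1.
Proof.
move=> p01; apply: le_trans (geometric_sum_le n p01).
have /andP[p0 p1] := p01.
rewrite mulr_natl -[X in _ *+ X]card_ord -sumr_const.
by apply: ler_sum => i _; rewrite ler_wiXn2l ?(ltW p1) // ltnW.
Qed.

End Geometric.

(** * Tail estimates and limits of the sums over closed paths *)

Section Estimates.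
Variables (R : realType) (X : graph) (K : nat) (t u : R[i]) (x : vertex X).
Hypothesis star_fin : forall y : vertex X, finite_set (star y).
Hypothesis degK : forall y : vertex X, (degree y <= K)%N.
Hypothesis K_gt0 : (0 < K)%N.
Hypothesis t_le1 : normc t <= 1.
Hypothesis u_small : K%:R * normc u < 1.
Implicit Types (C D : seq (edge X)).

(* sqrt (K |u|): writing K^n |u|^n as rho^n * rho^n leaves one factor rho^n
   for the decay and one for summability. *)
Let rho : R := Num.sqrt (K%:R * normc u).

Let rho_ge0 : 0 <= rho. Proof. exact: sqrtr_ge0. Qed.

Let Ku_ge0 : 0 <= K%:R * normc u.
Proof. by rewrite mulr_ge0 ?normc_ge0. Qed.

Let rho_lt1 : rho < 1.
Proof. by rewrite -(@sqrtr1 R) ltr_sqrt. Qed.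

Let rho_sqr n : K%:R ^+ n * normc u ^+ n = rho ^+ n * rho ^+ n.
Proof. by rewrite -!exprMn -expr2 sqr_sqrtr. Qed.

Let u_lt1 : normc u < 1.
Proof.
by apply: le_lt_trans u_small; rewrite ler_peMl ?normc_ge0 // ler1n.
Qed.

Definition path_term C : R[i] := (size C)%:R^-1 * t ^+ cbc C * u ^+ size C.

Definition path_weight D : R[i] := t ^+ cbc D * u ^+ size D.

Definition closed_sum N := \sum_(C <- fset_set (closed_upto x N)) path_term C.

Definition log_sum N :=
  \sum_(D <- fset_set (prim_upto x N))
    - (size D)%:R^-1 * clog (1 - path_weight D).

Lemma normc_path_weight D : normc (path_weight D) <= normc u ^+ size D.
Proof.
rewrite normcM !normcX ler_piMl ?exprn_ge0 ?normc_ge0 //.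
by rewrite exprn_ile1 ?normc_ge0.
Qed.

Lemma normc_path_term C : normc (path_term C) <= normc u ^+ size C.
Proof.
rewrite /path_term -mulrA normcM; apply: le_trans (normc_path_weight C).
rewrite ler_piMl ?normc_ge0 // normcV normc_nat.
case: (size C) => [|n]; first by rewrite invr0.
by rewrite invf_le1 // ler1n.
Qed.

(** Only paths of length n > N survive in the difference, and those of length n contribute at most
    K^n |u|^n = rho^n rho^n <= rho^N rho^n. The arbitrary [r] serves both the Cauchy property of
    [closed_sum] and the unordered partial sums. *)
Lemma closed_sum_tail N (r : seq (seq (edge X))) : uniq r ->
  {in r, forall C, closed_path_at x C} ->
  {subset (fset_set (closed_upto x N) : seq _) <= r} ->
  normc (\sum_(C <- r) path_term C - closed_sum N) <= rho ^+ N / (1 - rho).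
Proof.
move=> ur cr sr.
rewrite (bigID (fun C => size C <= N)%N) /= -big_filter.
rewrite [X in X + _ - _](_ : _ = closed_sum N); last first.
  apply: perm_big; apply: uniq_perm; [exact: filter_uniq|exact: fset_uniq|].
  move=> C; rewrite mem_filter.
  apply/andP/idP => [[CN Cr]|Cc]; first by rewrite (mem_closed_upto star_fin) (cr _ Cr).
  by split; [move: Cc; rewrite (mem_closed_upto star_fin) => /andP[]|exact: sr].
rewrite addrAC subrr add0r; apply: le_trans (normc_sum _ _ _) _.
(* Setting [F] to 0 up to N lets [sum_by_length] run over the whole of [r]. *)
pose F n := if (n <= N)%N then 0 else normc u ^+ n.
pose B := (\max_(C <- r) size C).+1.
apply: (@le_trans _ _ (\sum_(C <- r) F (size C))).
  rewrite [leRHS](bigID (fun C => size C <= N)%N) /= [X in X + _]big1 => [|C CN].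
    rewrite add0r; apply: ler_sum => C /negbTE CN.
    by rewrite /F CN normc_path_term.
  by rewrite /F CN.
apply: le_trans (_ : \sum_(n < B) K%:R ^+ n * F n <= _).
  apply: (sum_by_length star_fin degK (x := x)) => //.
    by move=> n; rewrite /F; case: ifP => // _; rewrite exprn_ge0 ?normc_ge0.
  by move=> C Cr; rewrite ltnS; exact: leq_bigmax_seq.
apply: le_trans (_ : \sum_(n < B) rho ^+ N * rho ^+ n <= _).
  apply: ler_sum => n _; rewrite /F; case: leqP => Nn.
    by rewrite mulr0 mulr_ge0 ?exprn_ge0.
  by rewrite rho_sqr ler_wpM2r ?exprn_ge0 // ler_wiXn2l ?(ltW rho_lt1) // ltnW.
rewrite -mulr_sumr ler_wpM2l ?exprn_ge0 // geometric_sum_le //.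
by rewrite rho_ge0.
Qed.

(** Each primitive D costs at most 2 |u|^N / (1 - |u|), there are at most (N + 1) K^N of them, and
    K^N |u|^N = rho^N rho^N. *)
Lemma log_sum_closed_sum N : normc (log_sum N - closed_sum N) <=
  (N.+1%:R * rho ^+ N) * rho ^+ N * (2 / (1 - normc u)).
Proof.
rewrite /log_sum /closed_sum (big_closed_upto star_fin) -sumrB.
have u1 := u_lt1.
apply: le_trans (normc_sum _ _ _) _.
pose c := normc u ^+ N * (2 / (1 - normc u)).
apply: (@le_trans _ _ (\sum_(D <- fset_set (prim_upto x N)) c)).
  rewrite big_seq [leRHS]big_seq; apply: ler_sum => D /(mem_prim_upto star_fin).
  move=> [[/andP[D0 _] _] DN].
  have w_le := normc_path_weight D.
  have u_le : normc u ^+ size D <= normc u.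
    by rewrite -[leRHS]expr1 ler_wiXn2l ?normc_ge0 ?(ltW u_lt1).
  have w_lt1 : normc (path_weight D) < 1 := le_lt_trans w_le (le_lt_trans u_le u_lt1).
  have := clog_taylor_bound (N %/ size D) w_lt1.
  set Cl := clog _; move=> h.
  (* Length and [cbc] are both multiplied by k in D^k, so its term is w_D^k / (k l(D)): the inner
     sum is 1 / l(D) times a Taylor polynomial of -log(1 - w_D). *)
  rewrite (_ : _ - _ = (size D)%:R^-1 * (- Cl -
    \sum_(k < N %/ size D) path_weight D ^+ k.+1 / k.+1%:R)); last first.
    rewrite mulrBr mulNr mulrN; congr (_ - _).
    rewrite -[X in iota 0 X]subn0 -/(index_iota _ _) big_mkord mulr_sumr.
    apply: eq_bigr => k _; rewrite /path_term size_seqpow cbc_seqpow //.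
    rewrite /path_weight exprMn -!exprM natrM invfM.
    by rewrite ![(k.+1 * _)%N]mulnC; ring.
  rewrite normcM normcV normc_nat.
  apply: le_trans (_ : 1 * normc (- Cl -
      \sum_(k < N %/ size D) path_weight D ^+ k.+1 / k.+1%:R) <= _).
    by rewrite ler_wpM2r ?normc_ge0 // invf_le1 ?ler1n ?ltr0n.
  rewrite mul1r; apply: le_trans h _.
  rewrite mulrCA /c; apply: ler_pM; rewrite ?exprn_ge0 ?divr_ge0 ?normc_ge0 //; first lra.
    apply: le_trans (_ : (normc u ^+ size D) ^+ (N %/ size D).+1 <= _).
      by rewrite lerXn2r ?nnegrE ?exprn_ge0 ?normc_ge0.
    rewrite -exprM ler_wiXn2l ?normc_ge0 ?(ltW u_lt1) //.
    (* The first omitted power of D has length (N / l(D) + 1) l(D), with integer division, which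
       exceeds N. *)
    by rewrite mulnC ltnW // ltn_ceil.
  by rewrite ler_wpM2l // lef_pV2 ?posrE; lra.
have c0 : 0 <= c by rewrite mulr_ge0 ?exprn_ge0 ?normc_ge0 // divr_ge0 //; lra.
apply: le_trans (_ : \sum_(n < N.+1) K%:R ^+ n * c <= _).
  apply: (sum_by_length star_fin degK (x := x) (F := fun=> c)) => //.
  - exact: fset_uniq.
  - by move=> D /(mem_prim_upto star_fin)[[]].
  - by move=> D /(mem_prim_upto star_fin)[_]; rewrite ltnS.
apply: le_trans (_ : \sum_(n < N.+1) K%:R ^+ N * c <= _).
  apply: ler_sum => n _; rewrite ler_wpM2r // ler_weXn2l ?ler1n //.
  by rewrite -ltnS.
by rewrite sumr_const card_ord /c mulrA rho_sqr -[leLHS]mulr_natl !mulrA.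
Qed.

Lemma cvg_rho : (fun N => rho ^+ N) @ \oo --> (0 : R).
Proof. by apply: cvg_expr; rewrite ger0_norm. Qed.

Lemma closed_sum_cauchy N m : (N <= m)%N ->
  normc (closed_sum m - closed_sum N) <= rho ^+ N / (1 - rho).
Proof.
move=> Nm; apply: closed_sum_tail => [|C|C]; first exact: fset_uniq.
  by rewrite (mem_closed_upto star_fin) => /andP[].
rewrite !(mem_closed_upto star_fin) => /andP[-> CN].
exact: leq_trans CN Nm.
Qed.

Lemma cvg_tail : (fun N => rho ^+ N / (1 - rho)) @ \oo --> (0 : R).
Proof. by rewrite -(mul0r (1 - rho)^-1); apply: cvgMl; exact: cvg_rho. Qed.

(** Completeness is applied in [R], to the real and imaginary parts of the Cauchy sequence. *)
Lemma cvg_closed_sum : cvg (closed_sum @ \oo).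
Proof.
have aux (phi : R[i] -> R) : (forall z w, phi (z - w) = phi z - phi w) ->
    (forall z, `|phi z| <= normc z) -> cvg ((fun N => phi (closed_sum N)) @ \oo).
  move=> phiB phi_le; apply/cauchy_cvgP/cauchy_exP => e e0.
  have /cvgrPdist_lt/(_ e e0)[N _ hN] := cvg_tail.
  exists (phi (closed_sum N)); exists N => // m Nm /=.
  rewrite -ball_normE /= distrC -phiB; apply: le_lt_trans (phi_le _) _.
  apply: le_lt_trans (closed_sum_cauchy Nm) _.
  by have := hN N (leqnn N); rewrite /= sub0r normrN; exact/le_lt_trans/ler_norm.
have cr := aux _ (@ReB R) (@Re_le_normc R).
have ci := aux _ (@ImB R) (@Im_le_normc R).
apply/cvg_ex.
exists (lim ((fun N => complex.Re (closed_sum N)) @ \oo)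
  +i* lim ((fun N => complex.Im (closed_sum N)) @ \oo)).
by apply/cvg_complexP; split; [exact: cr|exact: ci].
Qed.

Lemma cvg_log_sum : log_sum @ \oo --> lim (closed_sum @ \oo).
Proof.
have u1 := u_lt1.
have d0 : (fun N => normc (log_sum N - closed_sum N)) @ \oo --> (0 : R).
  (* By [mulrn_exp_le], (N + 1) rho^N <= 1 + 1 / (1 - rho); the second factor rho^N then gives the
     decay. *)
  have h : (fun N => (1 + (1 - rho)^-1) * (2 / (1 - normc u)) * rho ^+ N) @ \oo --> (0 : R).
    by rewrite -(mulr0 ((1 + (1 - rho)^-1) * (2 / (1 - normc u)))); apply: cvgMr; exact: cvg_rho.
  apply: (squeeze_cvgr (f := fun=> 0) _ (cvg_cst _) h).
  apply: nearW => N; rewrite normc_ge0 /=; apply: le_trans (log_sum_closed_sum N) _.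
  rewrite mulrAC ler_wpM2r ?exprn_ge0 // ler_wpM2r ?divr_ge0 //; first lra.
  rewrite -addn1 natrD mulrDl addrC mul1r lerD //.
    by rewrite exprn_ile1 // ltW.
  by rewrite mulrn_exp_le // rho_ge0.
apply/cvg_normcP.
have /cvg_normcP h := cvg_closed_sum.
apply: (squeeze_cvgr (f := fun=> 0) (h := fun N => 
  normc (lim (closed_sum @ \oo) - closed_sum N) + normc (log_sum N - closed_sum N))).
- apply: nearW => N; rewrite normc_ge0 /= -[X in _ <= _ + X]normcB.
  by rewrite -[X in normc X <= _](subrKA (closed_sum N)); exact: le_normcD.
- exact: cvg_cst.
- by rewrite -[X in _ --> X]addr0; apply: cvgD.
Qed.

(** Each principal power is by definition [cexp] of a multiple of [clog], so the finite product is
    [cexp] of [log_sum] with no ambiguity of branch; continuity of [cexp] concludes. *)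
Lemma cvg_euler_product :
  euler_product u t x @ \oo --> cexp (lim (closed_sum @ \oo)).
Proof.
rewrite (_ : euler_product u t x = (fun N => cexp (log_sum N))).
  exact: cvg_cexp cvg_log_sum.
apply/funext => N; rewrite /euler_product fsbig_finite; last exact: finite_prim_upto.
by rewrite cexp_sum.
Qed.

(** Any finite set of closed paths containing all those of length at most N has its sum within rho^N
    / (1 - rho) of [closed_sum N], itself close to the limit; each error takes e / 2. *)
Lemma cvg_partial_sum :
  summability.partial_sum (@zeta_term R X u t x) @ summability.totally
    --> lim (closed_sum @ \oo).
Proof.
set S := lim _.
have FF := @summability.totally_filter {C : seq (edge X) | closed_path_at x C}.
apply/cvg_normcP/cvgrPdist_le => e e0.
have /cvg_normcP/cvgrPdist_le/(_ (e / 2)) := cvg_closed_sum.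
have /cvgrPdist_le/(_ (e / 2)) := cvg_tail.
have e2 : 0 < e / 2 by rewrite divr_gt0.
move=> /(_ e2)[N1 _ h1] /(_ e2)[N2 _ h2].
pose N := maxn N1 N2.
have {}h1 : rho ^+ N / (1 - rho) <= e / 2.
  have := h1 N (leq_maxl _ _); rewrite /= sub0r normrN; exact/le_trans/ler_norm.
have {}h2 : normc (S - closed_sum N) <= e / 2.
  have := h2 N (leq_maxr _ _); rewrite /= sub0r normrN; exact/le_trans/ler_norm.
pose A : set {C : seq (edge X) | closed_path_at x C} := val @^-1` closed_upto x N.
have finA : finite_set A.
  by apply: finite_preimage (finite_closed_upto star_fin x N) => i j _ _; exact: val_inj.
exists (fset_set A) => // J AJ /=; rewrite sub0r normrN ger0_norm ?normc_ge0 //.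
have -> : summability.partial_sum (@zeta_term R X u t x) J =
    \sum_(C <- [seq val i | i <- (J : seq _)]) path_term C.
  by rewrite /summability.partial_sum big_map
    (big_seq_fsetE _ _ predT (fun i => path_term (val i))).
have tail : normc (\sum_(C <- [seq val i | i <- (J : seq _)]) path_term C - closed_sum N)
    <= rho ^+ N / (1 - rho).
  apply: closed_sum_tail.
  - by rewrite map_inj_uniq ?fset_uniq //; exact: val_inj.
  - by move=> C /mapP[i _ ->]; exact: valP.
  - move=> C; rewrite (mem_closed_upto star_fin) => /andP[cC CN].
    apply/mapP; exists (exist _ C cC) => //; apply: (fsubsetP AJ).
    by rewrite in_fset_set // inE /A /=; split.
rewrite -(subrKA (closed_sum N)); apply: le_trans (le_normcD _ _) _.
by rewrite [X in _ + X]normcB; lra.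
Qed.

Lemma zeta_euler_product :
  zeta_summable u t x /\ euler_product u t x @ \oo --> bartholdi_zeta u t x.
Proof.
split; first by apply/cvg_ex; exists (lim (closed_sum @ \oo)); exact: cvg_partial_sum.
have PF :=
  @summability.totally_filter {C : seq (edge X) | closed_path_at x C}.
rewrite /bartholdi_zeta /summability.sum (cvg_lim _ cvg_partial_sum) //.
exact: cvg_euler_product.
Qed.

End Estimates.

Unset Implicit Arguments.
Set Strict Implicit.

Theorem theorem5p1 (R : realType) (X : graph) (M : nat) (x0 : vertex X)
    (t u : R[i])
    (Xconn : connected_graph X) (Xcount : countable [set: vertex X])
    (Xsimple : simple_graph X) (XM : max_degree X M)
    (ht : normc t < 1)
    (hu : ((normc u)%:E < ((alpha M t)%:E)^-1)%E) :
  zeta_summable u t x0 /\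
  euler_product u t x0 @ \oo --> bartholdi_zeta u t x0.
Proof.
case: XM => star_fin deg_le _; have [M0|M_gt0] := posnP M.
  (* Here alpha = 0, so hu reads |u| < +oo and u is unrestricted; as there is
     no closed path, u may be replaced by 0. *)
  have no_edge (x : vertex X) e : ~ star x e.
    move=> xe; have := deg_le x.
    rewrite M0 leqn0 /degree cardfs_eq0 => /eqP/fsetP/(_ e).
    by rewrite in_fset_set // inE mem_set.
  have no_path (x : vertex X) C : ~ closed_path_at x C.
    by move=> /closed_path_edge[e]; exact: no_edge.
  have termE : @zeta_term R X u t x0 = @zeta_term R X 0 t x0.
    by apply/funext => -[C cC]; have := no_path _ _ cC.
  have prodE : euler_product u t x0 = euler_product 0 t x0.
    apply/funext => N; apply: eq_fsbigr => C /set_mem[[cC _] _].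
    by have := no_path _ _ cC.
  rewrite /zeta_summable /bartholdi_zeta termE prodE.
  (* The estimates require a positive degree bound, so 1 replaces M = 0. *)
  apply: (@zeta_euler_product _ _ 1) => //; last by rewrite normc0 mulr0.
    by move=> y; apply: leq_trans (deg_le y) _; rewrite M0.
  exact: ltW.
apply: (zeta_euler_product x0 star_fin deg_le M_gt0); first exact: ltW.
have M_pos : 0 < M%:R :> R by rewrite ltr0n.
(* The square root in [alpha] is at least M, so [alpha] is at least (M + M) / 2. *)
have M_le : M%:R <= alpha M t.
  have : M%:R <= Num.sqrt (M%:R ^+ 2 + 4 * (normc t + 1) * M%:R) :> R.
    rewrite -[leLHS]ger0_norm ?(ltW M_pos) // -sqrtr_sqr ler_wsqrtr // lerDl.
    by rewrite !mulr_ge0 ?addr_ge0 ?normc_ge0 // ltW.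
  by rewrite /alpha; lra.
have a0 : 0 < alpha M t := lt_le_trans M_pos M_le.
move: hu; rewrite inver gt_eqF // lte_fin => hu.
apply: le_lt_trans (_ : alpha M t * normc u < 1).
  by rewrite ler_wpM2r ?normc_ge0.
by rewrite mulrC -ltr_pdivlMr // div1r.
Qed.
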